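(* For every positive integer $k$, we have $p_{(k)}(n)\geq p_{(k+1)}(n)$ for all integers $n\geq 0$ with $n\neq k+1$. Moreover, for every integer $k\geq 2$, $p_{(k)}(k+1)-p_{(k+1)}(k+1)=-1$.
   Context: A partition of a positive integer $n$ is a non-increasing sequence of positive integers $\lambda=(\lambda_1,\ldots,\lambda_r)$ with sum $n$; the empty partition is the unique partition of $0$. The Young diagram of $\lambda$ is the left-justified array of boxes whose $i$-th row (from the top) has $\lambda_i$ boxes. The hook length of a box is the number of boxes directly to its right plus the number of boxes directly below it plus $1$. For a positive integer $k$, $p_{(k)}(n)$ denotes the total number of boxes of hook length $k$, counted over all partitions of $n$ (so $p_{(k)}(0)=0$). *)

(* Defs.v *)
From HB Require Import structures.
From mathcomp Require Import all_boot all_order all_algebra.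

Set Implicit Arguments.
Unset Strict Implicit.
Unset Printing Implicit Defensive.

Definition is_intpart (n : nat) (s : seq nat) : bool :=
  [&& sorted geq s, all (leq 1) s & sumn s == n].

Record intpart (n : nat) : Type :=
  IntPart { parts :> seq nat; partsP : is_intpart n parts }.

HB.instance Definition _ n := [isSub for @parts n].
HB.instance Definition _ n := [Countable of intpart n by <:].

(* A partition of n has at most n parts, each at most n, so intpart n embeds
   in the finite type of sequences of length <= n over 'I_n.+1; this is what
   allows summing over all partitions of n. *)
Section IntPartFinite.
Variable n : nat.

Definition intpart_to_bseq (l : intpart n) : {bseq n of 'I_n.+1} :=
  insub_bseq n [seq inord i | i <- parts l].

Definition intpart_of_bseq (t : {bseq n of 'I_n.+1}) : option (intpart n) :=
  insub [seq nat_of_ord i | i <- t].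

Lemma intpart_to_bseqK : pcancel intpart_to_bseq intpart_of_bseq.
Proof.
case=> s sP; have /and3P[_ s_gt0 /eqP s_n] := sP.
have size_s : size s <= n.
  rewrite -s_n; elim: s s_gt0 {sP s_n} => //= x s IHs /andP[x_gt0 /IHs].
  by rewrite -add1n; apply: leq_add.
have le_s x : x \in s -> x <= n.
  by move=> xs; rewrite -s_n (perm_sumn (perm_to_rem xs)) /= leq_addr.
rewrite /intpart_of_bseq /intpart_to_bseq /insub_bseq /=.
rewrite val_insubd /= size_map size_s -map_comp map_id_in.
  by rewrite insubT.
by move=> x xs /=; rewrite inordK // ltnS le_s.
Qed.

HB.instance Definition _ : isFinite (intpart n) :=
  PCanIsFinite intpart_to_bseqK.

End IntPartFinite.

(* A box is a pair (row, column), both numbered from 0. *)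
Definition young_diagram (s : seq nat) : seq (nat * nat) :=
  [seq (i, j) | i <- iota 0 (size s), j <- iota 0 (nth 0 s i)].

Definition hook_length (s : seq nat) (b : nat * nat) : nat :=
  count (fun c => (c.1 == b.1) && (b.2 < c.2)) (young_diagram s)
  + count (fun c => (c.2 == b.2) && (b.1 < c.1)) (young_diagram s)
  + 1.

Definition hook_count (k n : nat) : nat :=
  \sum_(l : intpart n)
     count (fun b => hook_length l b == k) (young_diagram l).

(* Main.v *)
(** Write p(n) for the number of partitions of n and h_k(n) for the number of
    hooks of length k in all of them.

    A partition padded with zeros to N parts is encoded by its beta-set, the set
    of the N beads [s_i + N - 1 - i]. A hook of length k is a bead x >= k whose
    position x - k is free, and removing it moves that bead to x - k. Counting
    the pairs before and after the move, and noting that in each beta-set k more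
    beads can move up by k than down by k, gives h_k(n+k) = h_k(n) + k p(n).

    In generating functions, the difference sum_n (h_k - h_{k+1})(n) q^n is
    q^k E(q) / ((1 - q^k)(1 - q^{k+1})), where the coefficient of q^x in E is
    sum_{1 <= i <= k} (Q(x) - Q(x-i)) and Q(x) = p(x) - p(x-1) counts the
    partitions of x without part 1. As Q is nondecreasing on x >= 1 (enlarge the
    largest part), E has a single negative coefficient, -1 at q. In the quotient
    each resulting term -q^{1+ak+b(k+1)} with a >= 1 is compensated by
    q^{(a-1)k+(b+1)(k+1)}, and with a = 0, b >= 1 by q^2 q^{k+(b-1)(k+1)}, so
    only the coefficient of q^1 stays negative. *)
Require Import Defs.
From mathcomp Require Import all_boot all_order all_algebra.
From mathcomp Require Import zify ring.

Set Implicit Arguments.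
Unset Strict Implicit.
Unset Printing Implicit Defensive.

(** * Partitions without part 1 *)

Lemma is_intpartP n (s : seq nat) :
  reflect [/\ sorted geq s, 0 \notin s & sumn s = n] (is_intpart n s).
Proof.
have -> : is_intpart n s = [&& sorted geq s, 0 \notin s & sumn s == n].
  rewrite /is_intpart; congr [&& _, _ & _].
  by elim: s => //= a s ->; rewrite in_cons negb_or eq_sym lt0n.
by apply: (iffP and3P) => -[? ? /eqP].
Qed.

Lemma geq_trans : transitive geq.
Proof. by move=> y x z xy yz; apply: leq_trans yz xy. Qed.

Lemma rcons1_intpart n (l : intpart n) : is_intpart n.+1 (rcons l 1).
Proof.
case: l => s /= /is_intpartP[ss s0 sn]; apply/is_intpartP; split.
- rewrite -cats1 (sorted_pairwise geq_trans) pairwise_cat /=.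
  rewrite -(sorted_pairwise geq_trans) ss !andbT.
  apply/allrelP => x y xs; rewrite inE => /eqP->.
  by rewrite /geq /= lt0n; apply: contraNneq s0 => <-.
- by rewrite mem_rcons in_cons.
- by rewrite sumn_rcons sn addn1.
Qed.

Definition intpart_rcons1 n (l : intpart n) : intpart n.+1 :=
  IntPart (rcons1_intpart l).

Definition num_intparts n := #|{: intpart n}|.

Definition intparts_no1 n : {set intpart n} :=
  [set l : intpart n | 1 \notin parts l].

Lemma sorted_geq_last1 (s : seq nat) : sorted geq s -> 0 \notin s -> 1 \in s ->
  exists t, s = rcons t 1.
Proof.
case/lastP: s => // s x ss; rewrite mem_rcons in_cons negb_or => /andP[x0 _] s1.
exists s; congr rcons; apply/eqP; rewrite eqn_leq lt0n eq_sym x0 andbT.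
move: s1; rewrite mem_rcons in_cons eq_sym => /predU1P[->//|s1].
move: ss; rewrite -cats1 (sorted_pairwise geq_trans) pairwise_cat.
case/andP=> /allrelP H _.
by apply: (H 1 x) => //; rewrite inE.
Qed.

(** Appending a part 1 maps the partitions of [n] bijectively onto the partitions of [n.+1] that
    contain 1. *)
Lemma num_intpartsS n : num_intparts n.+1 = num_intparts n + #|intparts_no1 n.+1|.
Proof.
rewrite /num_intparts -(cardsC (intparts_no1 n.+1)) addnC; congr addn.
have inj : injective (@intpart_rcons1 n).
  by move=> [s sP] [t tP] /(congr1 (@parts _))/= /rcons_inj[] ?; apply: val_inj.
rewrite -[RHS]cardsT -(card_imset _ inj); apply: eq_card => -[s sP].
rewrite !inE negbK /=; apply/idP/imsetP => [s1|]; last first.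
  by case=> l _ /(congr1 (@parts _))/= ->; rewrite mem_rcons mem_head.
have /is_intpartP[ss s0 sn] := sP.
have [t st] := sorted_geq_last1 ss s0 s1.
have tP : is_intpart n t.
  apply/is_intpartP; move: ss s0 sn; rewrite st -cats1 => ss s0 sn; split.
  - by case: (cat_sorted2 ss).
  - by move: s0; rewrite mem_cat negb_or => /andP[].
  - by move: sn; rewrite sumn_cat /= addn1 => -[].
by exists (IntPart tP) => //; apply: val_inj.
Qed.

Definition incr_head s := if s is a :: u then a.+1 :: u else [:: 1].

Lemma incr_head_intpart n (l : intpart n) : is_intpart n.+1 (incr_head l).
Proof.
case: l => -[|a u] /= /is_intpartP[ss s0 sn]; apply/is_intpartP.
  by split=> //; rewrite -sn.
split; [|by move: s0; rewrite !in_cons !negb_or => /andP[]|by rewrite /= addSn -sn].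
by case: u ss {s0 sn} => //= b u /andP[ab ->]; rewrite andbT; apply: leqW.
Qed.

(** Enlarging the largest part is injective and creates no part 1, except from the empty partition,
    which [0 < n] excludes. *)
Lemma intparts_no1_mono n : 0 < n -> #|intparts_no1 n| <= #|intparts_no1 n.+1|.
Proof.
move=> n0; pose f (l : intpart n) := IntPart (incr_head_intpart l).
have inj : injective f.
  move=> [s sP] [t tP] /(congr1 (@parts _))/= H; apply: val_inj => /=.
  case: s sP H => [|a u] sP; first by move: n0; case/is_intpartP: sP => _ _ <-.
  case: t tP => [|b v] tP /=; first by move: n0; case/is_intpartP: tP => _ _ <-.
  by case=> -> ->.
rewrite -(card_imset _ inj); apply: subset_leq_card; apply/subsetP => l'.
case/imsetP => -[s sP]; rewrite !inE /= => s1 -> /=.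
case: s sP s1 => [|a u] sP; first by move: n0; case/is_intpartP: sP => _ _ <-.
rewrite !in_cons /= !negb_or => /andP[a1 ->]; rewrite andbT.
by case/is_intpartP: sP; rewrite in_cons; case: a a1.
Qed.

Lemma num_intparts0 : num_intparts 0 = 1.
Proof.
have P : is_intpart 0 [::] by [].
rewrite /num_intparts -cardsT (_ : setT = [set IntPart P]) ?cards1 //.
apply/setP => -[s sP]; rewrite !inE; apply/esym/eqP; apply: val_inj => /=.
by case/is_intpartP: sP; case: s => // -[|a] u.
Qed.

Lemma intparts_no1_1 : #|intparts_no1 1| = 0.
Proof.
apply/eqP; rewrite cards_eq0; apply/eqP/setP => -[s sP]; rewrite !inE /=.
apply/negbTE; rewrite negbK; case/is_intpartP: sP => _.
case: s => [|[|[|a]] u] //=; rewrite ?mem_head.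
Qed.

Lemma intparts_no1_2 : 0 < #|intparts_no1 2|.
Proof.
have P : is_intpart 2 [:: 2] by [].
by apply/card_gt0P; exists (IntPart P); rewrite inE.
Qed.

Lemma intparts_no1_homo m n : 0 < m -> m <= n ->
  #|intparts_no1 m| <= #|intparts_no1 n|.
Proof.
move=> m0 /subnK <-; elim: (n - m) => // d IH.
by apply: leq_trans IH _; rewrite addSn intparts_no1_mono // ltn_addl.
Qed.

(** * Hooks and beta-numbers *)

Definition num_hooks k s :=
  count (fun b => hook_length s b == k) (young_diagram s).

Definition leg (t : seq nat) j := count (fun a => j < a) t.

(** When all parts are positive, these are the hook lengths of the first column; zero rows at the
    end give the padded beta-sets. *)
Fixpoint beta (s : seq nat) :=
  if s is a :: t then a + size t :: beta t else [::].

Lemma young_diagram_cons a t :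
  young_diagram (a :: t) =
  [seq (0, j) | j <- iota 0 a] ++ [seq (b.1.+1, b.2) | b <- young_diagram t].
Proof.
rewrite /young_diagram /=; congr cat.
by rewrite map_allpairs -[1]addn0 iotaDl allpairs_mapl.
Qed.

Lemma count_iota_gt j a : count (fun i => j < i) (iota 0 a) = a - j.+1.
Proof.
by elim: a => // a IH; rewrite -[in iota _ _]addn1 iotaD count_cat IH /=; lia.
Qed.

Lemma count_iota_eq j a : count (pred1 j) (iota 0 a) = (j < a).
Proof. by rewrite count_uniq_mem ?iota_uniq // mem_iota. Qed.

Lemma count_young_col t j : count (fun c => c.2 == j) (young_diagram t) = leg t j.
Proof.
elim: t => // a t IH; rewrite young_diagram_cons count_cat !count_map /= -IH.
by congr addn; rewrite -count_iota_eq; apply: eq_count => i /=; rewrite eq_sym.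
Qed.

Lemma hook_length_top a t j :
  j < a -> hook_length (a :: t) (0, j) = a - j + leg t j.
Proof.
move=> ja; rewrite /hook_length young_diagram_cons !count_cat !count_map /=.
rewrite (@eq_count _ _ (fun i => j < i)) // count_iota_gt.
rewrite [count _ (young_diagram t)](@eq_count _ _ pred0) ?count_pred0 //.
rewrite [count _ (iota 0 a)](@eq_count _ _ pred0) ?count_pred0; last first.
  by move=> i /=; rewrite andbF.
rewrite (@eq_count _ _ (fun c => c.2 == j)) ?count_young_col; first lia.
by move=> i /=; rewrite andbT.
Qed.

Lemma hook_length_below a t b :
  hook_length (a :: t) (b.1.+1, b.2) = hook_length t b.
Proof.
rewrite /hook_length young_diagram_cons !count_cat !count_map /=.
rewrite [count _ (iota 0 a)](@eq_count _ _ pred0) ?count_pred0 //.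
rewrite [count _ (iota 0 a)](@eq_count _ _ pred0) ?count_pred0 //.
by move=> i /=; rewrite andbF.
Qed.

Lemma num_hooks_cons k a t :
  num_hooks k (a :: t) =
  count (fun j => a - j + leg t j == k) (iota 0 a) + num_hooks k t.
Proof.
rewrite /num_hooks young_diagram_cons count_cat !count_map; congr addn.
  by apply: eq_in_count => j; rewrite mem_iota /= => ja; rewrite hook_length_top.
by apply: eq_count => b /=; rewrite hook_length_below.
Qed.

Lemma num_hooks_pad k s m : num_hooks k (s ++ nseq m 0) = num_hooks k s.
Proof.
have E : young_diagram (s ++ nseq m 0) = young_diagram s.
  elim: s => [|a s IH]; last by rewrite /= !young_diagram_cons IH.
  by elim: m => //= m; rewrite young_diagram_cons => ->.
by rewrite /num_hooks /hook_length E.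
Qed.

Lemma leg_le t j : leg t j <= size t.
Proof. exact: count_size. Qed.

Lemma beta_lt a t x : sorted geq (a :: t) -> x \in beta t -> x < a + size t.
Proof.
elim: t a => // b t IH a /= /andP[ab bt]; rewrite /geq /= in ab.
by rewrite in_cons => /predU1P[->|/(IH _ bt)]; lia.
Qed.

Lemma leg0 a t j : sorted geq (a :: t) -> a <= j -> leg t j = 0.
Proof.
elim: t a => // b t IH a /= /andP[ab bt] aj; rewrite /geq /= in ab.
by rewrite (IH b) //; lia.
Qed.

(* The gaps [j + size t - leg t j] are the numbers missed by [beta t]. *)
Lemma gaps_complement a t y : sorted geq (a :: t) -> y < a + size t ->
  count (fun j => j + size t - leg t j == y) (iota 0 a) + (y \in beta t) = 1.
Proof.
elim: t a y => [|b t IH] a y.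
  rewrite /= !addn0 => _ ya; rewrite (@eq_count _ _ (pred1 y)) ?count_iota_eq ?ya //.
  by move=> j /=; rewrite addn0 subn0.
move=> /= /andP[]; rewrite {1}/geq /= => ab bt ya; rewrite in_cons.
rewrite -(subnKC ab) iotaD count_cat add0n.
(* In columns [j < b] the row [b] lengthens both the leg and the list by one, so the gap stays the
   same. *)
have -> : count (fun j => j + (size t).+1 - ((j < b) + leg t j) == y) (iota 0 b)
        = count (fun j => j + size t - leg t j == y) (iota 0 b).
  by apply: eq_in_count => j; rewrite mem_iota /= => ->; congr (_ == _); lia.
(* Columns from [b] on have leg 0, so their gaps fill the interval above the bead [b + size t]. *)
have -> : count (fun j => j + (size t).+1 - ((j < b) + leg t j) == y) (iota b (a - b))
        = (b + size t < y).
  rewrite (@eq_in_count _ _ (preim (addn (size t).+1) (pred1 y))); last first.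
    move=> j; rewrite mem_iota /= => /andP[bj _].
    rewrite (leg0 bt bj) ltnNge bj /=; congr (_ == _); lia.
  rewrite -count_map -iotaDl count_uniq_mem ?iota_uniq // mem_iota.
  by congr nat_of_bool; lia.
case: (ltngtP y (b + size t)) => yb /=.
- by rewrite addn0 IH.
- rewrite (@eq_in_count _ _ pred0) ?count_pred0 => [|j]; last first.
    rewrite mem_iota /=; lia.
  by case: (boolP (y \in beta t)) => // /(beta_lt bt); lia.
- rewrite (@eq_in_count _ _ pred0) ?count_pred0 // => j.
  rewrite mem_iota /=; lia.
Qed.

Lemma sorted_behead a t : sorted geq (a :: t) -> sorted geq t.
Proof. by case: t => //= b t /andP[]. Qed.

(** The top-row hook in column [j] has length [a + size t] minus the gap of column [j]. So a hook of
    length [k] occurs there exactly when [a + size t - k] is a gap, and then once. For lower rows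
    the top bead is too large to occupy [x - k]. *)
Lemma num_hooks_beta k s : 0 < k -> sorted geq s ->
  num_hooks k s = count (fun x => (k <= x) && (x - k \notin beta s)) (beta s).
Proof.
move=> k0; elim: s => // a t IH ss; have st := sorted_behead ss.
rewrite num_hooks_cons (IH st) /=; congr addn.
- case: leqP => ka /=; last first.
    rewrite (@eq_in_count _ _ pred0) ?count_pred0 // => j.
    rewrite mem_iota /=; have := leg_le t j; lia.
  have ya : a + size t - k < a + size t by lia.
  have := gaps_complement ss ya.
  rewrite in_cons negb_or; have -> : a + size t - k != a + size t by lia.
  set c := count _ _; set c' := count _ _ => H.
  suff <- : c = c' by move: H; case: (_ \in _) => /=; lia.
  apply: eq_in_count => j; rewrite mem_iota /= => ja; have := leg_le t j; lia.
- apply: eq_in_count => x xt; rewrite in_cons.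
  have := beta_lt ss xt; case: (leqP k x) => //= kx xa.
  by have /negbTE-> : x - k != a + size t by lia.
Qed.

(** * Beta-sets as strictly decreasing lists *)

Lemma size_beta s : size (beta s) = size s.
Proof. by elim: s => //= a s ->. Qed.

Lemma sumn_beta s : sumn (beta s) = sumn s + 'C(size s, 2).
Proof. by elim: s => //= a s ->; rewrite binS bin1; lia. Qed.

Lemma sorted_beta s : sorted geq s -> sorted gtn (beta s).
Proof.
elim: s => // a s IH ss; have /IH := sorted_behead ss.
by case: s {IH} ss => //= b s /andP[ab _] ->; rewrite andbT; rewrite /geq /= in ab; lia.
Qed.

Lemma beta_uniq s : sorted geq s -> uniq (beta s).
Proof.
move/sorted_beta; apply: sorted_uniq; last exact: ltnn.
by move=> y x z /= xy yz; apply: ltn_trans yz xy.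
Qed.

Lemma beta_inj s t : size s = size t -> beta s = beta t -> s = t.
Proof.
by elim: s t => [|a s IH] [|b t] //= [st] [ab /(IH _ st) E]; congr cons => //; lia.
Qed.

Lemma beta_surj l : sorted gtn l -> exists2 s, sorted geq s & beta s = l.
Proof.
elim: l => [|x l IH] sl; first by exists [::].
have [|s ss sb] := IH; first by case: l {IH} sl => //= ? ? /andP[].
(* No truncation occurs: [x] heads a strictly decreasing list with [size s] further entries. *)
exists (x - size s :: s); last first.
  rewrite /= sb subnK // -(size_beta s) sb.
  elim: l x sl {IH sb ss} => // y l IH x /= /andP[xy /IH]; lia.
case: s ss sb sl => //= a s -> <- /= /andP[xy _]; rewrite andbT /geq /=; lia.
Qed.

(** Both sides count pairs of beads at distance [k], by the lower and by the upper bead. *)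
Lemma count_shift k (l : seq nat) : uniq l ->
  count (fun y => y + k \in l) l = count (fun y => (k <= y) && (y - k \in l)) l.
Proof.
move=> ul; rewrite -!size_filter -(size_map (addn^~ k)).
apply/perm_size/uniq_perm.
- by rewrite map_inj_uniq ?filter_uniq //; apply: addIn.
- by rewrite filter_uniq.
move=> y; rewrite mem_filter; apply/mapP/andP => [[x]|[/andP[ky yl] y'l]].
  by rewrite mem_filter => /andP[xk xl] ->; rewrite leq_addl addnK.
by exists (y - k); rewrite ?subnK // mem_filter subnK // y'l.
Qed.

(* The number of beads that can move up by [k] exceeds the number of beads that
   can move down by [k] by the number of beads below [k]. *)
Lemma count_addable k (l : seq nat) : uniq l -> {subset iota 0 k <= l} ->
  count (fun y => y + k \notin l) l =
  count (fun y => (k <= y) && (y - k \notin l)) l + k.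
Proof.
move=> ul sub.
have E1 : count (fun y => y + k \in l) l + count (fun y => y + k \notin l) l = size l.
  exact: count_predC.
have E2 : count (fun y => k <= y) l + count (fun y => ~~ (k <= y)) l = size l.
  exact: count_predC.
have E3 : count (fun y => ~~ (k <= y)) l = k.
  rewrite -size_filter -[RHS](size_iota 0); apply/perm_size/uniq_perm.
  - by rewrite filter_uniq.
  - exact: iota_uniq.
  move=> y; rewrite mem_filter /= -ltnNge mem_iota /= add0n.
  by apply: andb_idr => yk; rewrite sub // mem_iota.
have E4 : count (fun y => k <= y) l =
   count (fun y => (k <= y) && (y - k \in l)) l +
   count (fun y => (k <= y) && (y - k \notin l)) l.
  elim: {1 3 5}l => //= y t ->; case: (k <= y); case: (_ \in _) => /=; lia.
by move: E1; rewrite (count_shift k ul); lia.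
Qed.

Lemma mem_beta_catr s t y : y \in beta t -> y \in beta (s ++ t).
Proof. by elim: s => //= a s IH yt; rewrite in_cons IH ?orbT. Qed.

Lemma mem_beta_zeros m y : y < m -> y \in beta (nseq m 0).
Proof.
elim: m => //= m IH; rewrite in_cons size_nseq ltnS leq_eqVlt.
by case/predU1P=> [->|/IH->]; rewrite ?eqxx ?orbT.
Qed.

Lemma beta_bound s x : x \in beta s -> x < sumn s + size s.
Proof. by elim: s => //= a s IH; rewrite in_cons => /predU1P[->|/IH]; lia. Qed.

Lemma sum_ord_mem M (l : seq nat) (F : nat -> nat) :
  uniq l -> {in l, forall x, x < M} ->
  \sum_(x <- l) F x = \sum_(x : 'I_M | val x \in l) F x.
Proof.
move=> ul lM; rewrite -(big_map val (mem l) F) -[RHS]big_filter.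
apply: perm_big; apply: uniq_perm => //.
  by rewrite filter_uniq // map_inj_uniq ?index_enum_uniq //; apply: val_inj.
move=> y; rewrite mem_filter /= andb_idr // => yl.
by apply/mapP; exists (Ordinal (lM _ yl)); rewrite ?mem_index_enum.
Qed.

Lemma card_in_bij (T U : finType) (A : {set T}) (B : {set U})
    (f : T -> U) (g : U -> T) :
  {in A, forall x, f x \in B} -> {in B, forall y, g y \in A} ->
  {in A, cancel f g} -> {in B, cancel g f} -> #|A| = #|B|.
Proof.
move=> fB gA fK gK; apply/eqP; rewrite eqn_leq; apply/andP; split.
  rewrite -(card_in_imset (can_in_inj fK)); apply: subset_leq_card.
  by apply/subsetP => _ /imsetP[x xA ->]; apply: fB.
rewrite -(card_in_imset (can_in_inj gK)); apply: subset_leq_card.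
by apply/subsetP => _ /imsetP[x xA ->]; apply: gA.
Qed.

Lemma size_young_diagram s : size (young_diagram s) = sumn s.
Proof.
by elim: s => // a s IH; rewrite young_diagram_cons size_cat !size_map size_iota IH.
Qed.

(** The arm, the leg and the box itself are disjoint sets of boxes of the diagram. *)
Lemma hook_length_le s b : b \in young_diagram s -> hook_length s b <= sumn s.
Proof.
rewrite -size_young_diagram /hook_length -has_pred1 has_count.
set d := young_diagram s => bd; apply: leq_trans (leq_add (leqnn _) bd) _.
elim: d {bd} => //= c d IH.
have : (c.1 == b.1) && (b.2 < c.2) + (c.2 == b.2) && (b.1 < c.1) + (c == b) <= 1.
  by case: c b {IH d} => i j [i' j'] /=; rewrite xpair_eqE; lia.
by move: IH; rewrite /=; lia.
Qed.

Lemma hook_count_small k n : n < k -> hook_count k n = 0.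
Proof.
move=> nk; rewrite /hook_count big1 // => -[s sP] _ /=.
have /is_intpartP[_ _ sn] := sP.
rewrite (@eq_in_count _ _ pred0) ?count_pred0 // => b /hook_length_le.
by rewrite sn /=; lia.
Qed.

(** * The recursion for hook counts *)

Lemma size_le_sumn (s : seq nat) : 0 \notin s -> size s <= sumn s.
Proof.
by elim: s => //= a s IH; rewrite in_cons negb_or => /andP[a0 /IH]; lia.
Qed.

Lemma gtn_sorted_eq s t : sorted gtn s -> sorted gtn t -> s =i t -> s = t.
Proof.
apply: irr_sorted_eq => [y x z xy yz|x]; last exact: ltnn.
exact: ltn_trans yz xy.
Qed.

(** * Beta-sets with [N] beads as subsets of the positions 0 to [M] *)

Section BeadSets.
Variables M N : nat.

Definition pad s := s ++ nseq (N - size s) 0.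

Definition bead_set (s : seq nat) : {set 'I_M.+1} :=
  [set x : 'I_M.+1 | val x \in beta (pad s)].

(** The term ['C(N, 2)] is the sum of the beads 0, ..., N-1 of the empty partition. *)
Definition bead_sets n : {set {set 'I_M.+1}} :=
  [set X : {set 'I_M.+1} | (#|X| == N) && (\sum_(x in X) val x == n + 'C(N, 2))].

Lemma sorted_pad s : sorted geq s -> sorted geq (pad s).
Proof.
move=> ss; rewrite /pad (sorted_pairwise geq_trans) pairwise_cat.
rewrite -!(sorted_pairwise geq_trans) ss /=; apply/andP; split.
  by apply/allrelP => x y _ /nseqP[-> _].
by elim: (N - size s) => // -[|m] //= ->.
Qed.

Section FixedSize.
Variable n : nat.
(** The first bound makes every partition of [n] fit into [N] rows, the second makes its beads, all
    below [n + N], fit into the range. *)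
Hypotheses (nN : n <= N) (nM : n + N <= M.+1).

Lemma pad_intpart (l : intpart n) :
  [/\ sorted geq (pad l), size (pad l) = N & sumn (pad l) = n].
Proof.
case: l => s /= /is_intpartP[ss s0 sn]; split; first exact: sorted_pad.
  by rewrite size_cat size_nseq subnKC // (leq_trans (size_le_sumn s0)) ?sn.
by rewrite sumn_cat sumn_nseq mul0n addn0.
Qed.

Lemma bead_lt (l : intpart n) x : x \in beta (pad l) -> x < n + N.
Proof. by move/beta_bound; have [_ -> ->] := pad_intpart l. Qed.

Lemma sum_bead_set (l : intpart n) F :
  \sum_(x <- beta (pad l)) F x = \sum_(x in bead_set l) F (val x).
Proof.
have [sl _ _] := pad_intpart l.
rewrite (@sum_ord_mem M.+1) ?beta_uniq // => [|x /bead_lt xn]; last first.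
  exact: leq_trans xn nM.
by apply: eq_bigl => x; rewrite inE.
Qed.

Lemma bead_set_in (l : intpart n) : bead_set l \in bead_sets n.
Proof.
have [sl Nl nl] := pad_intpart l.
rewrite inE -sum1_card -(sum_bead_set l (fun=> 1)) -(sum_bead_set l id).
by rewrite sum1_size size_beta Nl eqxx -sumnE sumn_beta nl Nl eqxx.
Qed.

Lemma inord_bead_set (l : intpart n) y :
  y <= M -> (inord y \in bead_set l) = (y \in beta (pad l)).
Proof. by move=> yM; rewrite inE /= inordK. Qed.

Lemma beta_pad_inj (l l' : intpart n) : beta (pad l) = beta (pad l') -> l = l'.
Proof.
have [sl Nl nl] := pad_intpart l; have [sl' Nl' nl'] := pad_intpart l'.
move/beta_inj; rewrite Nl Nl' => /(_ erefl) E; apply: val_inj => /=.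
have F (m : intpart n) : filter (predC1 0) (pad m) = m.
  case: m => s /= /is_intpartP[_ s0 _]; rewrite filter_cat filter_nseq /= cats0.
  by apply/all_filterP/allP => x xs /=; apply: contraNneq s0 => <-.
by rewrite -(F l) -(F l') E.
Qed.

Lemma bead_set_inj : injective (fun l : intpart n => bead_set l).
Proof.
move=> l l' E; apply: beta_pad_inj.
have [sl _ _] := pad_intpart l; have [sl' _ _] := pad_intpart l'.
apply: gtn_sorted_eq; rewrite ?sorted_beta // => y.
case: (leqP y M) => yM; first by rewrite -!inord_bead_set ?E.
by apply/idP/idP => /bead_lt; lia.
Qed.

(** List the beads in decreasing order, decode them into a nonincreasing list [t], and drop its
    zeros; they stand at the end, so padding restores [t]. *)
Lemma bead_set_surj X : X \in bead_sets n ->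
  exists l : intpart n, X = bead_set l.
Proof.
rewrite inE => /andP[/eqP XN /eqP Xn].
pose b := rev [seq val x | x <- enum X].
have bs : sorted gtn b.
  rewrite rev_sorted; apply: (@subseq_sorted _ ltn ltn_trans _ (iota 0 M.+1)).
    rewrite -val_enum_ord map_subseq //.
    by rewrite [enum 'I_M.+1]enumT; apply: filter_subseq.
  exact: iota_ltn_sorted.
have [t ts tb] := beta_surj bs.
have tN : size t = N by rewrite -size_beta tb size_rev size_map -cardE.
have tn : sumn t = n.
  apply/(@addIn 'C(N, 2)); rewrite -Xn -tN -sumn_beta tb sumn_rev.
  by rewrite sumnE big_map big_enum.
pose s := filter (predC1 0) t.
have tE : t = s ++ nseq (N - size s) 0.
  rewrite -tN /s {tb tN tn bs b s Xn XN X}.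
  elim: t ts => // a t IH ts; have := IH (sorted_behead ts).
  case: a ts => [|a] ts E /=; last by rewrite subSS {1}E.
  have tz : t = nseq (size t) 0.
    apply/all_pred1P; apply: sub_all (order_path_min geq_trans ts) => x.
    by rewrite /= leqn0.
  by rewrite tz filter_nseq /= size_nseq.
have sP : is_intpart n s.
  apply/is_intpartP; split.
  - exact: sorted_filter geq_trans _ _ ts.
  - by rewrite mem_filter.
  - by move: tn; rewrite tE sumn_cat sumn_nseq mul0n addn0.
exists (IntPart sP); apply/setP => x.
by rewrite inE /pad /= -tE tb mem_rev mem_map ?mem_enum //; apply: val_inj.
Qed.

Lemma sum_intpart_beads (F : {set 'I_M.+1} -> nat) :
  \sum_(l : intpart n) F (bead_set l) = \sum_(X in bead_sets n) F X.
Proof.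
have -> : bead_sets n = [set bead_set l | l : intpart n].
  apply/setP => X; apply/idP/imsetP => [/bead_set_surj[l ->]|[l _ ->]].
    by exists l.
  exact: bead_set_in.
by rewrite big_imset //= => l l' _ _; apply: bead_set_inj.
Qed.

Lemma num_hooks_bead_set k (l : intpart n) : 0 < k ->
  num_hooks k l =
  \sum_(x in bead_set l) ((k <= x) && (inord (x - k) \notin bead_set l)).
Proof.
move=> k0; have [sl _ _] := pad_intpart l.
rewrite -(num_hooks_pad k l (N - size l)) num_hooks_beta // -sum1_count.
rewrite big_mkcond /= sum_bead_set; apply: eq_bigr => x _.
rewrite inord_bead_set; first by case: ifP.
by rewrite (leq_trans (leq_subr _ _)) // -ltnS.
Qed.

(** With [n + k <= N] the padding has at least [k] zero rows, so all positions below [k] are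
    occupied and [count_addable] supplies the summand [k]. The bound on [M] keeps [x + k] in range,
    so [inord] does not fall back to its default. *)
Lemma num_hooks_addable k (l : intpart n) : 0 < k ->
  n + k <= N -> n + k + N <= M.+1 ->
  num_hooks k l + k = \sum_(x in bead_set l) (inord (x + k) \notin bead_set l).
Proof.
move=> k0 nkN nkM; have [sl _ _] := pad_intpart l.
rewrite -(num_hooks_pad k l (N - size l)) num_hooks_beta //.
rewrite -count_addable ?beta_uniq // => [|x]; last first.
  rewrite mem_iota /= => xk; apply: mem_beta_catr; apply: mem_beta_zeros.
  have /is_intpartP[_ /size_le_sumn ? ?] := partsP l; apply: leq_trans xk _; lia.
rewrite -sum1_count big_mkcond /= sum_bead_set; apply: eq_bigr => x.
rewrite inE => /bead_lt /= xl; rewrite inord_bead_set; first by case: ifP.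
by lia.
Qed.
End FixedSize.

Lemma card_sum_pairs (A : {set {set 'I_M.+1}})
    (P : {set 'I_M.+1} -> 'I_M.+1 -> bool) :
  \sum_(X in A) \sum_(x in X) P X x =
  #|[set p : {set 'I_M.+1} * 'I_M.+1 | [&& p.1 \in A, p.2 \in p.1 & P p.1 p.2]]|.
Proof.
rewrite pair_big_dep -sum1dep_card /=.
rewrite [RHS](eq_bigl (fun p => ((p.1 \in A) && (p.2 \in p.1)) && P p.1 p.2));
  last first.
  by move=> p; rewrite andbA.
by rewrite [RHS]big_mkcondr; apply: eq_bigr => p _; case: (P _ _).
Qed.

Definition move_bead (x y : 'I_M.+1) (X : {set 'I_M.+1}) := y |: (X :\ x).

Lemma move_beadK x y (X : {set _}) : x \in X -> y \notin X ->
  move_bead y x (move_bead x y X) = X.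
Proof.
move=> xX yX; rewrite /move_bead setU1K ?setD1K //.
by rewrite !inE negb_and yX orbT.
Qed.

(** The equation [n + y = m + x] records the change of the bead sum without subtraction, for moves
    in both directions. *)
Lemma move_bead_in n m x y (X : {set _}) : X \in bead_sets n -> x \in X -> y \notin X ->
  n + y = m + x -> move_bead x y X \in bead_sets m.
Proof.
rewrite !inE => /andP[/eqP XN /eqP Xn] xX yX nm.
have yX' : y \notin X :\ x by rewrite !inE negb_and yX orbT.
have XN' : #|X :\ x|.+1 = N by rewrite -XN (cardsD1 x X) xX.
rewrite cardsU1 yX' add1n XN' eqxx big_setU1 //=.
by move: Xn; rewrite (big_setD1 x) //=; set S := \sum_(_ in _) _; lia.
Qed.
End BeadSets.

(* Moving a bead down by [k] turns a partition of [n + k] with a chosen hook of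
   length [k] into a partition of [n] with a chosen bead that can move up by [k]. *)
Lemma hook_count_rec k n : 0 < k ->
  hook_count k (n + k) = hook_count k n + k * num_intparts n.
Proof.
(* [N] rows hold every partition of [n + k] and leave [k] zero rows below one of [n]. All beads
   involved, before and after a move, are below [N + N]. *)
move=> k0; pose N := n + k; pose M := N + N.
have nN : n <= N by rewrite leq_addr.
have nM : n + N <= M.+1 by rewrite /M /N; lia.
have NM : N + N <= M.+1 by rewrite /M; lia.
have -> : hook_count k n + k * num_intparts n =
    \sum_(l : intpart n) (num_hooks k l + k).
  by rewrite big_split /= sum_nat_const mulnC.
transitivity (\sum_(l : intpart (n + k)) num_hooks k l) => //.
under eq_bigr => l _ do rewrite (num_hooks_bead_set (leqnn N) NM) //.
under [RHS]eq_bigr => l _ do rewrite (num_hooks_addable nN nM) //.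
rewrite (sum_intpart_beads (leqnn N) NM (fun X => \sum_(x in X)
  ((k <= x) && (inord (x - k) \notin X)))).
rewrite (sum_intpart_beads nN nM (fun X => \sum_(x in X) (inord (x + k) \notin X))).
rewrite !card_sum_pairs.
pose f (p : {set 'I_M.+1} * 'I_M.+1) : {set 'I_M.+1} * 'I_M.+1 :=
  (move_bead p.2 (inord (p.2 - k)) p.1, inord (p.2 - k)).
pose g (p : {set 'I_M.+1} * 'I_M.+1) : {set 'I_M.+1} * 'I_M.+1 :=
  (move_bead p.2 (inord (p.2 + k)) p.1, inord (p.2 + k)).
have subK (x : 'I_M.+1) : k <= x -> val (inord (x - k) : 'I_M.+1) = x - k.
  by move=> kx; rewrite /= inordK //; have := ltn_ord x; lia.
have addK X x : X \in bead_sets M N n -> x \in X ->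
    val (inord (x + k) : 'I_M.+1) = x + k.
  move=> /bead_set_surj[l ->]; rewrite inE => /(bead_lt nN) /= xn.
  by rewrite /= inordK //; move: xn; rewrite /M /N; lia.
apply: (@card_in_bij _ _ _ _ f g) => -[X x]; rewrite inE /= => /and3P[XB xX].
- case/andP=> kx x'X; have := subK x kx; rewrite /= => E.
  have E' : inord ((inord (x - k) : 'I_M.+1) + k) = x :> 'I_M.+1.
    by apply: val_inj; rewrite /= E subnK // inordK.
  rewrite inE /= E' (move_bead_in XB) //=; last by rewrite E; lia.
  rewrite /move_bead setU11 /= !inE eqxx /= orbF.
  by apply: contraNneq x'X => <-.
- move=> x'X; have := addK X x XB xX; rewrite /= => E.
  have E' : inord ((inord (x + k) : 'I_M.+1) - k) = x :> 'I_M.+1.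
    by apply: val_inj; rewrite /= E addnK // inordK.
  rewrite inE /= E' (move_bead_in XB) //=; last by rewrite E; lia.
  rewrite /move_bead setU11 /= !inE eqxx /= orbF E leq_addl /=.
  by apply: contraNneq x'X => <-.
- case/andP=> kx x'X; have := subK x kx; rewrite /= => E.
  have E' : inord ((inord (x - k) : 'I_M.+1) + k) = x :> 'I_M.+1.
    by apply: val_inj; rewrite /= E subnK // inordK.
  by rewrite /g /f /= E' move_beadK.
- move=> x'X; have := addK X x XB xX; rewrite /= => E.
  have E' : inord ((inord (x + k) : 'I_M.+1) - k) = x :> 'I_M.+1.
    by apply: val_inj; rewrite /= E addnK // inordK.
  by rewrite /g /f /= E' move_beadK.
Qed.

Import Order.TTheory GRing.Theory Num.Theory.

(** * The inequality *)

Section Inequality.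
Local Open Scope ring_scope.

(** Extension by zero lets the recursions hold at every integer, including where a shifted argument
    is negative. *)
Definition zext (u : nat -> nat) (x : int) : int :=
  if x is Posz n then (u n)%:Z else 0.

Lemma zext_neg u (x : int) : x < 0 -> zext u x = 0.
Proof. by case: x. Qed.

Lemma zext_hook_rec k (x : int) : (0 < k)%N ->
  zext (hook_count k) x =
  zext (hook_count k) (x - k%:Z) + k%:Z * zext num_intparts (x - k%:Z).
Proof.
move=> k0; case: (ltP x k%:Z) => xk.
  rewrite !(@zext_neg _ (x - k%:Z)) ?subr_lt0 // mulr0 addr0.
  by case: x xk => //= n nk; rewrite hook_count_small.
have [n ->] : exists n : nat, x = (n + k)%N%:Z by exists `|x - k%:Z|%N; lia.
have -> : (n + k)%N%:Z - k%:Z = n%:Z by lia.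
by rewrite /= hook_count_rec // PoszD PoszM.
Qed.

Definition zno1 (x : int) : int := zext num_intparts x - zext num_intparts (x - 1).

Lemma zno1S n : zno1 n.+1%:Z = #|intparts_no1 n.+1|%:Z.
Proof.
rewrite /zno1; have -> : n.+1%:Z - 1 = n%:Z by lia.
by rewrite /= num_intpartsS PoszD addrC addKr.
Qed.

Lemma zno1_0 : zno1 0 = 1.
Proof. by rewrite /zno1 /= num_intparts0. Qed.

Lemma zno1_1 : zno1 1 = 0.
Proof. by rewrite (zno1S 0) intparts_no1_1. Qed.

Lemma zno1_neg (x : int) : x < 0 -> zno1 x = 0.
Proof. by move=> x0; rewrite /zno1 !zext_neg //; lia. Qed.

Lemma zno1_2 (x : int) : 2 <= x -> 1 <= zno1 x.
Proof.
case: x => // -[|n] n2 //; rewrite zno1S.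
have := @intparts_no1_homo 2 n.+1 erefl; have := intparts_no1_2; lia.
Qed.

(** The only descent of [zno1] is from its value 1 at 0 to its value 0 at 1. *)
Lemma zno1_le (x y : int) : y <= x -> x != 1 -> zno1 y <= zno1 x.
Proof.
move=> yx x1; case: (ltP y 0) => y0.
  rewrite (zno1_neg y0); case: (ltP x 0) => x0; first by rewrite zno1_neg.
  have [->|] := eqVneq x 0; first by rewrite zno1_0.
  by move=> ?; have := @zno1_2 x; lia.
have [y00|yn0] := eqVneq y 0.
  rewrite y00 zno1_0; have [->|xn0] := eqVneq x 0; first by rewrite zno1_0.
  by apply: zno1_2; lia.
case: y y0 yn0 yx => // -[|m] // _ _; case: x x1 => // -[|n] // _ mn.
by rewrite !zno1S lez_nat; apply: intparts_no1_homo.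
Qed.

(* The coefficient of [q^x] in the numerator E(q), in closed form. *)
Definition source k (x : int) : int :=
  k%:Z * zext num_intparts x - k.+1%:Z * zext num_intparts (x - 1)
  + zext num_intparts (x - 1 - k%:Z).

Lemma source0 (x : int) : source 0 x = 0.
Proof. by rewrite /source subr0; ring. Qed.

(** With [source0] this identifies the closed form with the sum of Q(x) - Q(x-i) over i from 1 to k,
    where Q is [zno1]. *)
Lemma sourceS k (x : int) : source k.+1 x = source k x + (zno1 x - zno1 (x - k.+1%:Z)).
Proof.
rewrite /source /zno1.
have -> : x - 1 - k.+1%:Z = x - k.+1%:Z - 1 by lia.
have -> : x - 1 - k%:Z = x - k.+1%:Z by lia.
have -> : k.+2%:Z = k%:Z + 2 by lia.
have -> : k.+1%:Z = k%:Z + 1 by lia.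
by ring.
Qed.

Lemma source_ge0 k (x : int) : x != 1 -> 0 <= source k x.
Proof.
move=> x1; elim: k => [|k IH]; first by rewrite source0.
by rewrite sourceS addr_ge0 // subr_ge0 zno1_le //; lia.
Qed.

Lemma source_at0 k : source k 0 = k%:Z.
Proof.
by elim: k => [|k IH]; [rewrite source0|rewrite sourceS IH zno1_0 zno1_neg; lia].
Qed.

Lemma source_at1 k : (0 < k)%N -> source k 1 = -1.
Proof.
case: k => // k _; elim: k => [|k IH]; rewrite sourceS ?source0 ?IH zno1_1.
  by rewrite subrr zno1_0.
by rewrite zno1_neg; lia.
Qed.

Lemma source_at2 k : (0 < k)%N -> 1 <= source k 2.
Proof.
case: k => // k _; elim: k => [|k IH]; rewrite sourceS.
  by rewrite source0 zno1_1 add0r subr0; apply: zno1_2.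
by rewrite (le_trans IH) // lerDl subr_ge0 zno1_le //; lia.
Qed.

(** * Signs of the coefficients of the quotient *)

Variable k : nat.
Hypothesis k0 : (0 < k)%N.

(* Arguments are shifted by [k]: [hook_diff x] is (h_k - h_{k+1})(x + k), the
   coefficient of [q^x] in E(q) / ((1 - q^k)(1 - q^{k+1})); [hook_diff2 x] is
   the one in E(q) / (1 - q^k). *)
Definition hook_diff (x : int) : int :=
  zext (hook_count k) (x + k%:Z) - zext (hook_count k.+1) (x + k%:Z).

Definition hook_diff2 (x : int) : int := hook_diff x - hook_diff (x - k.+1%:Z).

Lemma hook_diff_neg (x : int) : x < 0 -> hook_diff x = 0.
Proof.
move=> x0; rewrite /hook_diff; case: (ltP (x + k%:Z) 0) => xk.
  by rewrite !zext_neg.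
have : x + k%:Z < k%:Z by lia.
case: (x + k%:Z) xk => //= n _ nk.
by rewrite !hook_count_small //; lia.
Qed.

Lemma hook_diff2_neg (x : int) : x < 0 -> hook_diff2 x = 0.
Proof. by move=> x0; rewrite /hook_diff2 !hook_diff_neg //; lia. Qed.

(** Apply the recursion of h_k at two arguments differing by [k.+1], and that of h_{k+1} at two
    differing by [k]. The hook counts cancel and the partition numbers left over form [source]. *)
Lemma hook_diff2_rec (x : int) : hook_diff2 x = hook_diff2 (x - k%:Z) + source k x.
Proof.
rewrite /hook_diff2 /hook_diff /source.
rewrite (zext_hook_rec (x + k%:Z) k0).
rewrite (zext_hook_rec (x - k.+1%:Z + k%:Z) k0).
rewrite (@zext_hook_rec k.+1 (x + k%:Z)) //.
rewrite (@zext_hook_rec k.+1 (x - k%:Z + k%:Z)) //.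
have -> : x + k%:Z - k%:Z = x by lia.
have -> : x - k%:Z + k%:Z = x by lia.
have -> : x - k.+1%:Z + k%:Z = x - 1 by lia.
have -> : x + k%:Z - k.+1%:Z = x - 1 by lia.
have -> : x - k%:Z - k.+1%:Z + k%:Z = x - k.+1%:Z by lia.
have -> : x - 1 - k%:Z = x - k.+1%:Z by lia.
have -> : k.+1%:Z = k%:Z + 1 by lia.
by ring.
Qed.

Lemma hook_diff_rec (x : int) : hook_diff x = hook_diff2 x + hook_diff (x - k.+1%:Z).
Proof. by rewrite /hook_diff2 subrK. Qed.

Lemma int_ind_step (P : int -> Prop) (h : nat) : (0 < h)%N ->
  (forall x : int, x < 0 -> P x) ->
  (forall x : int, 0 <= x -> P (x - h%:Z) -> P x) ->
  forall x, P x.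
Proof.
move=> h0 Pneg Pstep x; case: (ltP x 0) => [/Pneg//|].
case: x => // n _; elim/ltn_ind: n => n IH; apply: Pstep => //.
case: (leqP h n) => hn; last by apply: Pneg; lia.
have -> : n%:Z - h%:Z = (n - h)%N%:Z by lia.
by apply: IH; lia.
Qed.

(** Steps of [k] meet the only negative source, -1 at 1, at most once, so the deficit reaches only 1
    + ak and never exceeds one. *)
Lemma hook_diff2_dichotomy (x : int) : (1 < k)%N ->
  0 <= hook_diff2 x \/ exists2 a : nat, x = 1 + a%:Z * k%:Z & -1 <= hook_diff2 x.
Proof.
move=> k1; move: x; apply: (int_ind_step k0) => x x0.
  by left; rewrite hook_diff2_neg.
rewrite (hook_diff2_rec x); have [->|x1] := eqVneq x 1 => IH.
  right; exists 0%N; first lia.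
  by rewrite hook_diff2_neg ?source_at1 //; lia.
have := source_ge0 k x1; case: IH => [? ?|[a xa ?] ?]; first by left; lia.
right; exists a.+1; last lia.
have -> : a.+1%:Z * k%:Z = a%:Z * k%:Z + k%:Z by rewrite intS; ring.
by lia.
Qed.

Lemma hook_diff2_mul a : (1 < k)%N -> k%:Z <= hook_diff2 (a%:Z * k%:Z).
Proof.
move=> k1; elim: a => [|a IH]; rewrite hook_diff2_rec.
  by rewrite mul0r source_at0 hook_diff2_neg; lia.
have -> : a.+1%:Z * k%:Z - k%:Z = a%:Z * k%:Z by rewrite intS; ring.
rewrite (le_trans IH) // lerDl source_ge0 //.
(* No multiple of [k] equals 1, so the exceptional source is never met. *)
by rewrite -PoszM; apply/eqP => -[]; move: k1; nia.
Qed.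

(** The positive source at 2 survives to [k + 2], where it offsets the value -1 of [hook_diff] at 1,
    one step of [k.+1] earlier. *)
Lemma hook_diff2_k2 : (1 < k)%N -> 1 <= hook_diff2 (k%:Z + 2).
Proof.
move=> k1; rewrite hook_diff2_rec; have -> : k%:Z + 2 - k%:Z = 2 by lia.
rewrite hook_diff2_rec.
have h : 0 <= hook_diff2 (2 - k%:Z).
  case: (ltngtP k 2) => k2; [lia|by rewrite hook_diff2_neg; lia|].
  have -> : 2 - k%:Z = 0 by lia.
  by have := hook_diff2_mul 0 k1; rewrite mul0r; apply: le_trans.
by rewrite -addrA ler_wpDl // ler_wpDr ?source_at2 // source_ge0 //; lia.
Qed.

Lemma hook_diff_at1 : (1 < k)%N -> hook_diff 1 = -1.
Proof.
move=> k1; rewrite hook_diff_rec hook_diff2_rec source_at1 //.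
by rewrite hook_diff2_neg ?hook_diff_neg; lia.
Qed.

(** The bound at multiples of [k] strengthens the induction: it pays for the deficits of
    [hook_diff2]. *)
Lemma hook_diff_ge0_gt1 (x : int) : (1 < k)%N ->
  (x != 1 -> 0 <= hook_diff x) /\
  (forall a : nat, x = a%:Z * k%:Z -> 1 <= hook_diff x).
Proof.
move=> k1; move: x; apply: (@int_ind_step _ k.+1) => // x x0.
  split=> [_|a xa]; first by rewrite hook_diff_neg.
  by move: x0; rewrite xa -PoszM.
have d1 := hook_diff_at1 k1.
case=> IH1 IH2; split=> [x1|a xa]; rewrite hook_diff_rec.
  have [y1|/IH1 y0] := eqVneq (x - k.+1%:Z) 1.
    have -> : x = k%:Z + 2 by lia.
    have -> : k%:Z + 2 - k.+1%:Z = 1 by lia.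
    by have := hook_diff2_k2 k1; lia.
  (* A deficit at 1 + (a+1)k is paid for by the surplus at ak, which is exactly [x - k.+1]. *)
  case: (hook_diff2_dichotomy x k1) => [?|[[|a] xa ?]]; [lia|lia|].
  have /IH2 : x - k.+1%:Z = a%:Z * k%:Z.
    have : a.+1%:Z * k%:Z = a%:Z * k%:Z + k%:Z by rewrite intS; ring.
    by lia.
  lia.
(* The contribution here is at least [k], hence at least 2, which leaves 1 even if the earlier term
   is -1. *)
have := hook_diff2_mul a k1; rewrite -xa.
have [->|/IH1] := eqVneq (x - k.+1%:Z) 1; lia.
Qed.

(** For [k = 1] the source 1 at 0 lies on the same chain as the source -1 at 1 and cancels it, so
    there is no exception. *)
Lemma hook_diff_ge0_eq1 (x : int) : k = 1%N -> 0 <= hook_diff x.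
Proof.
move=> k1; have f0 y : 0 <= hook_diff2 y.
  move: y; apply: (int_ind_step k0) => y y0; first by rewrite hook_diff2_neg.
  rewrite (hook_diff2_rec y); have [->|/(source_ge0 k)] := eqVneq y 1; last lia.
  have -> : 1 - k%:Z = 0 by lia.
  rewrite hook_diff2_rec source_at0 source_at1 // hook_diff2_neg; lia.
move: x; apply: (@int_ind_step _ k.+1) => // x x0; first by rewrite hook_diff_neg.
by rewrite (hook_diff_rec x); have := f0 x; lia.
Qed.

Lemma hook_diff_ge0 (x : int) : x != 1 -> 0 <= hook_diff x.
Proof.
move=> x1; case: (ltngtP k 1) => k1; [lia| |exact: hook_diff_ge0_eq1].
by case: (hook_diff_ge0_gt1 x k1) => /(_ x1).
Qed.

End Inequality.

Theorem theorem1p1 :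
  (forall k n : nat, 0 < k -> n <> k.+1 ->
     hook_count k.+1 n <= hook_count k n) /\
  (forall k : nat, 2 <= k ->
     ((hook_count k k.+1)%:Z - (hook_count k.+1 k.+1)%:Z = -1)%R).
Proof.
split=> k => [n k0 nk|k2].
  have := @hook_diff_ge0 k k0 (n%:Z - k%:Z)%R; rewrite /hook_diff subrK /=; lia.
have := @hook_diff_at1 k (ltnW k2) k2; rewrite /hook_diff.
by have -> : (1 + k%:Z = k.+1%:Z)%R by lia.
Qed.
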